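(* Consider the multistage stochastic problem, the Bellman operators $\mathfrak B_t$, the value functions $V_t$, the sets $X_t$, the set-valued mappings $\mathcal U_t^w$, the selection functions and the Tropical Dynamic Programming (TDP) algorithm described in the context. Assume: (1) the noises $\mathbf W_1,\dots,\mathbf W_T$ are independent with finite supports; (2) for every $t\in\{0,\dots,T\}$ the set $X_t$ is nonempty and compact, and $x_0\in X_0$; (3) for every $t\in\{0,\dots,T-1\}$ and $w\in\mathrm{supp}(\mathbf W_{t+1})$, the functions $f_t^w$ and $c_t^w$ are Lipschitz continuous on $\mathrm{dom}\,c_t^w$, and there is a constant $L_{\mathcal U_t^w}>0$ such that $d_{\mathcal H}(\mathcal U_t^w(x_1),\mathcal U_t^w(x_2))\le L_{\mathcal U_t^w}\|x_1-x_2\|$ for all $x_1,x_2\in X_t$ (with $d_{\mathcal H}$ the Hausdorff distance); moreover $\psi$ is Lipschitz continuous on $X_T$; (4) for every $t\in\{0,\dots,T-1\}$, $w\in\mathrm{supp}(\mathbf W_{t+1})$ and $x\in X_t$, the set $\mathcal U_t^w(x)$ is nonempty and compact. Let $(\overline V_t^k)_{k\in\mathbb N}$ and $(\underline V_t^k)_{k\in\mathbb N}$, $t\in\{0,\dots,T\}$, be the approximations generated by TDP, let $(x_t^k)_{0\le t\le T}$ be the problem-child trajectory computed at iteration $k$, and let $\overline V_t^*=\lim_k\overline V_t^k$ and $\underline V_t^*=\lim_k\underline V_t^k$ be the limits on $X_t$. Then for every $t\in\{0,\dots,T\}$, $$\overline V_t^k(x_t^k)-\underline V_t^k(x_t^k)\underset{k\to+\infty}{\longrightarrow}0,$$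 and for every accumulation point $x_t^*$ of the sequence $(x_t^k)_{k\in\mathbb N}$, $$\overline V_t^*(x_t^* )=\underline V_t^*(x_t^* ).$$
   Context: Setting. $T\ge1$, $\mathbb X=\mathbb R^n$, $\mathbb U=\mathbb R^m$ with Euclidean norms; $x_0\in\mathbb X$ is a given initial state. $\mathbf W_t$ ($t=1,\dots,T$) is a random variable with values in a measurable set $\mathbb W_t$, with finite support $\mathrm{supp}(\mathbf W_t)=\{w:\mathbb P(\mathbf W_t=w)>0\}$ carrying all the probability mass. For $t\in\{0,\dots,T-1\}$ and $w\in\mathrm{supp}(\mathbf W_{t+1})$: dynamics $f_t^w:\mathbb X\times\mathbb U\to\mathbb X$ and cost $c_t^w:\mathbb X\times\mathbb U\to\mathbb R\cup\{+\infty\}$; final cost $\psi:\mathbb X\to\mathbb R\cup\{+\infty\}$. $\mathrm{dom}\,g=\{g<+\infty\}$. Sets. $X_T=\mathrm{dom}\,\psi$ and, for $t<T$, $X_t=\bigcap_{w\in\mathrm{supp}(\mathbf W_{t+1})}\pi_{\mathbb X}(\mathrm{dom}\,c_t^w)$, where $\pi_{\mathbb X}(x,u)=x$. For $t<T$, $\mathcal U_t^w(x)=\{u\in\mathbb U: c_t^w(x,u)<+\infty\text{ and }f_t^w(x,u)\in X_{t+1}\}$. Bellman operators. For $\phi:\mathbb X\to\overline{\mathbb R}$, $\mathcal B_t^w(\phi)(x)=\inf_{u\in\mathbb U}\big(c_t^w(x,u)+\phi(f_t^w(x,u))\big)$ and $\mathfrak B_t(\phi)(x)=\mathbb E[\mathcal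 B_t^{\mathbf W_{t+1}}(\phi)(x)]$. Value functions: $V_T=\psi$, $V_t=\mathfrak B_t(V_{t+1})$ for $t<T$. Under the hypotheses of the claim, $\mathrm{dom}\,V_t=X_t$ and $V_t$ is Lipschitz continuous on $X_t$; fix for each $t$ a constant $L_{V_t}>0$ such that $V_t$ is $L_{V_t}$-Lipschitz on $X_t$. Basic functions. A basic function at time $t$ is a function $\phi:\mathbb X\to\mathbb R\cup\{+\infty\}$ that is real-valued and $L_{V_t}$-Lipschitz continuous on $X_t$ and equals $+\infty$ outside $X_t$. Let $\overline{\mathbf F}_t$ and $\underline{\mathbf F}_t$ be given sets of basic functions at time $t$. For $F\subset\overline{\mathbf F}_t$ put $\overline{\mathcal V}_F=\inf_{\phi\in F}\phi$; for $F\subset\underline{\mathbf F}_t$ put $\underline{\mathcal V}_F=\sup_{\phi\in F}\phi$ (pointwise). Selection functions. For $t<T$, an upper selection function $\overline S_t$ assigns to each nonempty finite $F\subset\overline{\mathbf F}_{t+1}$ and $x\in X_t$ a function $\overline S_t(F,x)\in\overline{\mathbf F}_t$ such that $\overline S_t(F,x)(x)=\mathfrak B_t(\overline{\mathcal V}_F)(x)$ (tightness) and $\overline S_t(F,x)\ge\mathfrak B_t(\overline{\mathcal V}_F)$ on $X_t$ (validity). A lower selection function $\underline S_t$ assigns to each nonempty finite $F\subset\underline{\mathbf F}_{t+1}$ and $x\in X_t$ a function $\underline S_t(F,x)\in\underline{\mathbf F}_t$ with $\underline S_t(F,x)(x)=\mathfrak B_t(\underline{\mathcal V}_F)(x)$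 and $\underline S_t(F,x)\le\mathfrak B_t(\underline{\mathcal V}_F)$ on $X_t$. For $t=T$, $\overline S_T:X_T\to\overline{\mathbf F}_T$ and $\underline S_T:X_T\to\underline{\mathbf F}_T$ satisfy $\overline S_T(x)(x)=\underline S_T(x)(x)=V_T(x)$, $\overline S_T(x)\ge V_T$ and $\underline S_T(x)\le V_T$ on $X_T$. Problem-child trajectory for functions $\overline\phi_0,\dots,\overline\phi_T$ and $\underline\phi_0,\dots,\underline\phi_T$: set $x_0^*=x_0$; for $t=0,\dots,T-1$, for each $w\in\mathrm{supp}(\mathbf W_{t+1})$ choose $u_t^w\in\arg\min_{u\in\mathbb U}\big(c_t^w(x_t^*,u)+\underline\phi_{t+1}(f_t^w(x_t^*,u))\big)$; choose $w^*\in\arg\max_{w\in\mathrm{supp}(\mathbf W_{t+1})}(\overline\phi_{t+1}-\underline\phi_{t+1})(f_t^w(x_t^*,u_t^w))$; set $x_{t+1}^*=f_t^{w^*}(x_t^*,u_t^{w^*})$. All ties are broken arbitrarily. TDP algorithm. Given upper and lower selection functions $\overline S_t,\underline S_t$ for all $t$, set $\overline F_t^0=\underline F_t^0=\emptyset$. For $k=0,1,2,\dots$: (forward) compute the problem-child trajectory $(x_t^k)_{0\le t\le T}$ for $(\overline V_t^k)_t$ and $(\underline V_t^k)_t$, where $\overline V_t^k=\inf_{\phi\in\overline F_t^k}\phi$ and $\underline V_t^k=\sup_{\phi\in\underline F_t^k}\phi$; (backward) set $\overline F_T^{k+1}=\overline F_T^k\cup\{\overline S_T(x_T^k)\}$,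 $\underline F_T^{k+1}=\underline F_T^k\cup\{\underline S_T(x_T^k)\}$, and for $t=T-1,\dots,0$, $\overline F_t^{k+1}=\overline F_t^k\cup\{\overline S_t(\overline F_{t+1}^{k+1},x_t^k)\}$, $\underline F_t^{k+1}=\underline F_t^k\cup\{\underline S_t(\underline F_{t+1}^{k+1},x_t^k)\}$. Convention for the initial iteration $k=0$, where no approximation is available: the trajectory $(x_t^0)_t$ is any trajectory with $x_0^0=x_0$ and $x_{t+1}^0=f_t^{w}(x_t^0,u)$ for some $w\in\mathrm{supp}(\mathbf W_{t+1})$ and $u\in\mathcal U_t^{w}(x_t^0)$. For $k\ge1$ the functions $\overline V_t^k,\underline V_t^k$ are real-valued on $X_t$ and are respectively nonincreasing and nondecreasing in $k$; $\overline V_t^*$, $\underline V_t^*$ denote their limits on $X_t$. *)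

(* Defs.v *)
From HB Require Import structures.
From mathcomp Require Export all_boot all_order all_algebra.
From mathcomp Require Export all_classical all_reals all_analysis.

Set Implicit Arguments.
Unset Strict Implicit.
Unset Printing Implicit Defensive.

Import Order.TTheory GRing.Theory Num.Theory.
Import numFieldNormedType.Exports.

Local Open Scope classical_set_scope.
Local Open Scope ring_scope.

(* The library norm on matrices is the sup norm; its topology on ['rV[R]_n]
   (used for compactness and accumulation points) is the Euclidean one. *)
Definition enorm (R : realType) (n : nat) (v : 'rV[R]_n) : R :=
  Num.sqrt (\sum_(i < n) v 0 i ^+ 2).

(* Euclidean norm on R^n x R^m = R^(n + m) *)
Definition enorm2 (R : realType) (n m : nat) (z : 'rV[R]_n * 'rV[R]_m) : R :=
  enorm (row_mx z.1 z.2).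

Definition edom (R : realType) (A : Type) (g : A -> \bar R) : set A :=
  [set a | (g a < +oo)%E].

(* [g] is real-valued on [D] and [L]-Lipschitz there, for the norm [N] on the
   source. *)
Definition elipschitz_on (R : realType) (V : zmodType) (N : V -> R) (L : R)
    (D : set V) (g : V -> \bar R) : Prop :=
  (forall x, D x -> g x \is a fin_num) /\
  (forall x y, D x -> D y -> `|fine (g x) - fine (g y)| <= L * N (x - y)).

Definition lipschitz_on2 (R : realType) (n m p : nat) (L : R)
    (D : set ('rV[R]_n * 'rV[R]_m)) (f : 'rV[R]_n * 'rV[R]_m -> 'rV[R]_p) :
    Prop :=
  forall z1 z2, D z1 -> D z2 -> enorm (f z1 - f z2) <= L * enorm2 (z1 - z2).

Definition dist_to_set (R : realType) (n : nat) (a : 'rV[R]_n)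
    (B : set 'rV[R]_n) : \bar R :=
  ereal_inf [set (enorm (a - b))%:E | b in B].

Definition hausdorff_dist (R : realType) (n : nat) (A B : set 'rV[R]_n) :
    \bar R :=
  maxe (ereal_sup [set dist_to_set a B | a in A])
       (ereal_sup [set dist_to_set b A | b in B]).

(* Expectation of an extended-real random variable, with the convention
   (+oo) + (-oo) = +oo, usual in minimization: [%dE] is the library's dual
   addition, which satisfies it, whereas the library integral uses
   (+oo) + (-oo) = -oo. *)
Definition eexpectation (R : realType) (d : measure_display)
    (Omega : measurableType d) (P : probability Omega R)
    (Y : Omega -> \bar R) : \bar R :=
  ((\int[P]_o (Y^\+ o))%E - (\int[P]_o (Y^\- o))%E)%dE.

(* Data of a multistage stochastic problem with states in R^n and controls in
   R^m. Only [noise t] for 1 <= t <= horizon, and [dyn t w], [cost t w] for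
   t < horizon and w in the support of [noise t.+1], are meaningful. *)
Record msp (R : realType) (n m : nat) (d : measure_display)
    (Omega : measurableType d) (P : probability Omega R)
    (dW : nat -> measure_display) (W : forall t, measurableType (dW t)) := MSP {
  horizon : nat;
  noise : forall t, {RV P >-> W t};
  dyn : forall t, W t.+1 -> 'rV[R]_n * 'rV[R]_m -> 'rV[R]_n;
  cost : forall t, W t.+1 -> 'rV[R]_n * 'rV[R]_m -> \bar R;
  final_cost : 'rV[R]_n -> \bar R;
  init_state : 'rV[R]_n
}.
Arguments noise {R n m d Omega P dW W} _ t.

Section Problem.
Context {R : realType} {n m : nat} {d : measure_display}.
Context {Omega : measurableType d} {P : probability Omega R}.
Context {dW : nat -> measure_display} {W : forall t, measurableType (dW t)}.

Local Notation X := 'rV[R]_n.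
Local Notation U := 'rV[R]_m.
Local Notation xfun := (X -> \bar R).

Implicit Types (p : msp n m P W) (t : nat) (phi : xfun) (F : set xfun).

Definition supp p t : set (W t) :=
  [set w | (0 < P (noise p t @^-1` [set w]))%E].
Arguments supp p t _ : clear implicits.

(* The measurability clause is what makes P(noise t = w) meaningful. *)
Definition finitely_supported p t : Prop :=
  [/\ forall w, measurable (noise p t @^-1` [set w]),
      finite_set (supp p t) &
      P (noise p t @^-1` supp p t) = 1%E].

(* Subfamilies are covered by taking [A t = setT]. *)
Definition independent_noises p : Prop :=
  forall A : forall t, set (W t), (forall t, measurable (A t)) ->
  P (\bigcap_(t in [set t | (1 <= t <= horizon p)%N]) noise p t @^-1` A t) =
  (\prod_(1 <= t < (horizon p).+1) P (noise p t @^-1` A t))%E.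

Definition Xset p t : set X :=
  if (t < horizon p)%N then
    \bigcap_(w in supp p t.+1) (fst @` edom (cost p w))
  else edom (final_cost p).

Definition Uset p t (w : W t.+1) (x : X) : set U :=
  [set u | (cost p w (x, u) < +oo)%E /\ Xset p t.+1 (dyn p w (x, u))].

Definition stage_cost p t (w : W t.+1) phi (x : X) (u : U) : \bar R :=
  (cost p w (x, u) + phi (dyn p w (x, u)))%dE.

Definition bellman_at p t (w : W t.+1) phi (x : X) : \bar R :=
  ereal_inf (range (stage_cost p w phi x)).

Definition bellman p t phi (x : X) : \bar R :=
  eexpectation P (fun o => bellman_at p (noise p t.+1 o) phi x).

(* [value_to_go p k] is the value function at time [horizon p - k]. *)
Fixpoint value_to_go p (k : nat) : xfun :=
  if k is k'.+1 then bellman p (horizon p - k'.+1) (value_to_go p k')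
  else final_cost p.

Definition value p t : xfun := value_to_go p (horizon p - t).

Definition basic p (LV : nat -> R) t phi : Prop :=
  elipschitz_on (@enorm R n) (LV t) (Xset p t) phi /\
  (forall x, ~ Xset p t x -> phi x = +oo%E).

Definition inf_of F : xfun := fun x => ereal_inf [set phi x | phi in F].
Definition sup_of F : xfun := fun x => ereal_sup [set phi x | phi in F].

Section Selection.
Variables (p : msp n m P W) (Fbar Flow : nat -> set xfun).

Definition upper_selection t (S : set xfun -> X -> xfun) : Prop :=
  forall F x, finite_set F -> F !=set0 -> F `<=` Fbar t.+1 -> Xset p t x ->
  [/\ Fbar t (S F x),
      S F x x = bellman p t (inf_of F) x &
      forall y, Xset p t y -> (bellman p t (inf_of F) y <= S F x y)%E].

Definition lower_selection t (S : set xfun -> X -> xfun) : Prop :=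
  forall F x, finite_set F -> F !=set0 -> F `<=` Flow t.+1 -> Xset p t x ->
  [/\ Flow t (S F x),
      S F x x = bellman p t (sup_of F) x &
      forall y, Xset p t y -> (S F x y <= bellman p t (sup_of F) y)%E].

Definition upper_selection_final (S : X -> xfun) : Prop :=
  forall x, Xset p (horizon p) x ->
  [/\ Fbar (horizon p) (S x),
      S x x = value p (horizon p) x &
      forall y, Xset p (horizon p) y -> (value p (horizon p) y <= S x y)%E].

Definition lower_selection_final (S : X -> xfun) : Prop :=
  forall x, Xset p (horizon p) x ->
  [/\ Flow (horizon p) (S x),
      S x x = value p (horizon p) x &
      forall y, Xset p (horizon p) y -> (S x y <= value p (horizon p) y)%E].

End Selection.

(* [x] is one of the problem-child trajectories: every way of breaking ties in
   the argmin and argmax is allowed. *)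
Definition problem_child p (phibar philow : nat -> xfun) (x : nat -> X) : Prop :=
  x 0%N = init_state p /\
  forall t, (t < horizon p)%N ->
  exists (u : W t.+1 -> U) (ws : W t.+1),
    [/\ forall w, supp p t.+1 w -> forall v,
          (stage_cost p w (philow t.+1) (x t) (u w) <=
           stage_cost p w (philow t.+1) (x t) v)%E,
        supp p t.+1 ws,
        forall w, supp p t.+1 w ->
          (phibar t.+1 (dyn p w (x t, u w)) -
             philow t.+1 (dyn p w (x t, u w)) <=
           phibar t.+1 (dyn p ws (x t, u ws)) -
             philow t.+1 (dyn p ws (x t, u ws)))%E &
        x t.+1 = dyn p ws (x t, u ws)].

Definition admissible_trajectory p (x : nat -> X) : Prop :=
  x 0%N = init_state p /\
  forall t, (t < horizon p)%N ->
  exists (w : W t.+1) (u : U),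
    [/\ supp p t.+1 w, Uset p w (x t) u & x t.+1 = dyn p w (x t, u)].

(* [Fb k t] and [Fl k t] are the sets of upper and lower basic functions at
   time [t] before iteration [k], and [x k] is the trajectory computed at
   iteration [k]. *)
Record tdp_run p
    (Sbar Slow : nat -> set xfun -> X -> xfun) (SbarT SlowT : X -> xfun)
    (Fb Fl : nat -> nat -> set xfun) (x : nat -> nat -> X) : Prop := TDPRun {
  tdp_init : forall t, (t <= horizon p)%N -> Fb 0%N t = set0 /\ Fl 0%N t = set0;
  tdp_forward0 : admissible_trajectory p (x 0%N);
  tdp_forward : forall k, (0 < k)%N ->
    problem_child p (fun t => inf_of (Fb k t)) (fun t => sup_of (Fl k t)) (x k);
  tdp_backwardT : forall k,
    Fb k.+1 (horizon p) = Fb k (horizon p) `|` [set SbarT (x k (horizon p))] /\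
    Fl k.+1 (horizon p) = Fl k (horizon p) `|` [set SlowT (x k (horizon p))];
  tdp_backward : forall k t, (t < horizon p)%N ->
    Fb k.+1 t = Fb k t `|` [set Sbar t (Fb k.+1 t.+1) (x k t)] /\
    Fl k.+1 t = Fl k t `|` [set Slow t (Fl k.+1 t.+1) (x k t)]
}.

End Problem.

Arguments supp {R n m d Omega P dW W} p t _.

(* Main.v *)
(* Write gap^k_t for the difference between the upper and the lower
   approximation at time t before iteration k: it is nonnegative, nonincreasing
   in k, and equicontinuous on X_t. Tightness of the selections at x_t^k,
   monotonicity of the Bellman operator, and the choice of the control and of
   the worst noise along the problem-child trajectory give
     gap^{k+1}_T (x_T^k) = 0  and
     gap^{k+1}_t (x_t^k) <= gap^k_{t+1} (x_{t+1}^k)  for t < T.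
   On the compact set X_t the decrements gap^k_t - gap^{k+1}_t tend to 0
   uniformly, so backward induction on t gives gap^k_t (x_t^k) --> 0. At an
   accumulation point, equicontinuity makes gap^k_t arbitrarily small for some
   k, and monotonicity makes its limit vanish. *)

Require Import Defs.
From mathcomp Require Import all_boot all_order all_algebra.
From mathcomp Require Import all_classical all_reals all_analysis.
From mathcomp Require Import finmap measurable_realfun.
From mathcomp Require Import lra.

Set Implicit Arguments.
Unset Strict Implicit.
Unset Printing Implicit Defensive.

Import Order.TTheory GRing.Theory Num.Theory.
Import numFieldNormedType.Exports.
Import DualAddTheory.

Local Open Scope classical_set_scope.
Local Open Scope ring_scope.

Section expectation.
Local Open Scope ereal_scope.
Context {d : measure_display} {T : measurableType d} {R : realType}.
Import HBNNSimple.

(* No measurability is assumed, so the comparison is made on the simple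
   functions below [f], cut off to the set where [f <= g]. *)
Lemma ge0_ae_le_integralT (mu : {measure set T -> \bar R}) (f g : T -> \bar R) :
  (forall x, 0 <= f x) -> (forall x, 0 <= g x) ->
  {ae mu, forall x, f x <= g x} ->
  \int[mu]_x f x <= \int[mu]_x g x.
Proof.
move=> f0 g0 [N [mN N0 fgN]]; rewrite !ge0_integralTE//.
apply: ge_ereal_sup => _ [h /= hf <-].
have mNC := measurableC mN.
have -> : sintegral mu h = sintegral mu (h \_ (~` N)).
  rewrite -integralT_nnsfun (ge0_negligible_integral mN)//.
  - by rewrite setTD integral_nnsfun.
  - exact: measurableT_comp.
  - by move=> x _; rewrite lee_fin.
apply: ereal_sup_ubound.
exists (proj_nnsfun h mNC) => [x|]; rewrite -mrestrict//.
rewrite patchE; case: ifPn => [/set_mem /= Nx|_] //.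
by apply: le_trans (hf x) _; apply: contra_notP Nx => /fgN.
Qed.

Implicit Types (P : probability T R) (Y Z : T -> \bar R).

Lemma ae_le_eexpectation P Y Z :
  {ae P, forall o, Y o <= Z o} -> eexpectation P Y <= eexpectation P Z.
Proof.
move=> YZ; rewrite /eexpectation; apply: lee_dB.
  apply: ge0_ae_le_integralT => //; apply: filterS YZ => o YZo.
  by rewrite !funeposE le_max2.
apply: ge0_ae_le_integralT => //; apply: filterS YZ => o YZo.
by rewrite !funenegE le_max2// leeN2.
Qed.

Lemma ae_eq_eexpectation P Y Z :
  {ae P, forall o, Y o = Z o} -> eexpectation P Y = eexpectation P Z.
Proof.
by move=> YZ; apply/eqP; rewrite eq_le; apply/andP; split;
  apply: ae_le_eexpectation; apply: filterS YZ => o ->.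
Qed.

Lemma eexpectation_integral P Y :
  P.-integrable setT Y -> eexpectation P Y = \int[P]_o Y o.
Proof.
move=> iY; rewrite /eexpectation [RHS]integralE dual_addeE_def//.
exact: integrable_add_def.
Qed.

Lemma eexpectationD_cst P Y (r : R) : P.-integrable setT Y ->
  eexpectation P (fun o => Y o + r%:E) = eexpectation P Y + r%:E.
Proof.
move=> iY.
have ir : P.-integrable setT (cst r%:E : T -> \bar R).
  exact: finite_measure_integrable_cst.
rewrite !eexpectation_integral//; last exact: integrableD.
by rewrite integralD// integral_cst//= probability_setT mule1.
Qed.

End expectation.

Section finite_noise.
Local Open Scope ereal_scope.
Context {d d' : measure_display} {T : measurableType d} {R : realType}.
Context {E : measurableType d'}.
Variables (P : probability T R) (N : T -> E) (S : set E).
Hypothesis mN : forall w, measurable (N @^-1` [set w]).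
Hypothesis finS : finite_set S.
Hypothesis PS : P (N @^-1` S) = 1.

Lemma ae_in_finite_support : {ae P, forall o, S (N o)}.
Proof.
have mS : measurable (N @^-1` S).
  rewrite -[S]image_id -bigcup_imset1 preimage_bigcup.
  by apply: fin_bigcup_measurable => // w _; exact: mN.
exists (~` (N @^-1` S)); split => //; first exact: measurableC.
by rewrite probability_setC// PS subee.
Qed.

Lemma integrable_finite_noise (g : E -> \bar R) :
  (forall w, S w -> g w \is a fin_num) ->
  exists2 Y : T -> \bar R, P.-integrable setT Y &
    {ae P, forall o, Y o = g (N o)}.
Proof.
move=> gS; pose s := enum_fset (fset_set S).
exists (fun o => \sum_(w <- s) (fine (g w))%:E * (\1_(N @^-1` [set w]) o)%:E).
  apply: integrable_sum => // w _; apply: integrableZl => //.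
  exact: integrable_indic.
apply: filterS ae_in_finite_support => o So.
have No : N o \in s by rewrite in_fset_set//; exact/mem_set.
rewrite (bigD1_seq (N o)) ?fset_uniq//=.
rewrite indicE mem_set//= mule1 fineK ?gS// big1 ?adde0// => w wN.
by rewrite indicE memNset ?mule0// => /= /esym /eqP; rewrite (negbTE wN).
Qed.

Lemma eexpectation_finite_noise_leD (g1 g2 : E -> \bar R) (r : R) :
  (forall w, S w -> g1 w \is a fin_num) ->
  (forall w, S w -> g2 w <= g1 w + r%:E) ->
  eexpectation P (g2 \o N) <= eexpectation P (g1 \o N) + r%:E.
Proof.
move=> g1S g12; have [Y iY YE] := integrable_finite_noise g1S.
rewrite -(ae_eq_eexpectation YE) -eexpectationD_cst//.
apply: ae_le_eexpectation; apply: filterS2 YE ae_in_finite_support => o ->.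
exact: g12.
Qed.

End finite_noise.

Section finite_extrema.
Context {R : realType}.
Implicit Type A : set (\bar R).

Lemma finite_ereal_sup_mem A : finite_set A -> A !=set0 -> A (ereal_sup A).
Proof.
move=> /finite_fsetP[X ->] [x /= xX].
have [y _ ymax] := @arg_maxP _ _ X [` xX]%fset xpredT (@fsval _ X) isT.
suff -> : ereal_sup [set` X] = fsval y by have := fsvalP y.
apply/eqP; rewrite eq_le ereal_sup_ubound ?andbT//=.
by apply/ereal_supP => z /= zX; exact: (ymax [` zX]%fset isT).
Qed.

Lemma finite_ereal_inf_mem A : finite_set A -> A !=set0 -> A (ereal_inf A).
Proof.
move=> finA A0; rewrite ereal_infEN.
have [||z Az <-] := @finite_ereal_sup_mem (-%E @` A).
- exact: finite_image.
- exact: image_nonempty.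
- by rewrite oppeK.
Qed.

End finite_extrema.

Section euclidean_norm.
Context {R : realType} {n : nat}.
Implicit Types x y : 'rV[R]_n.

Lemma enorm_ge0 x : 0 <= enorm x.
Proof. exact: sqrtr_ge0. Qed.

Lemma enorm_le_norm x : enorm x <= Num.sqrt n%:R * `|x|.
Proof.
rewrite -(normr_id x) -sqrtr_sqr -sqrtrM// ler_wsqrtr//.
rewrite -[X in (X%:R * _)]card_ord -sumr_const mulr_suml.
apply: ler_sum => i _; rewrite mul1r -real_normK ?num_real//.
rewrite lerXn2r ?nnegrE// [leRHS]mx_normrE.
exact: (le_bigmax _ (fun ij : _ * _ => `|x ij.1 ij.2|) (0, i)).
Qed.

Lemma near_enorm_lt x (e : R) : 0 < e -> \forall y \near x, enorm (y - x) < e.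
Proof.
move=> e0; have s0 : 0 < Num.sqrt n%:R + 1 :> R by rewrite ltr_wpDl// sqrtr_ge0.
near=> y; apply: le_lt_trans (enorm_le_norm _) _.
apply: (@le_lt_trans _ _ ((Num.sqrt n%:R + 1) * `|y - x|)).
  by rewrite ler_wpM2r// lerDl.
rewrite mulrC -ltr_pdivlMr// distrC; near: y.
by apply: cvgr_dist_lt; rewrite ?divr_gt0.
Unshelve. all: by end_near. Qed.

End euclidean_norm.

Lemma cluster_frequently {I : Type} {V : topologicalType} (F : set_system I)
    {FF : Filter F} (u : I -> V) (v : V) (Q : set I) (B : set V) :
  cluster (u i @[i --> F]) v -> F Q -> nbhs v B -> exists2 i, Q i & B (u i).
Proof.
move=> uv FQ Bv; have [|_ [[i Qi <-] Bi]] := uv (u @` Q) B _ Bv.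
  by apply: (@filterS _ F) FQ => i Qi; exists i.
by exists i.
Qed.

Lemma cluster_shiftS {V : topologicalType} (u : nat -> V) (v : V) :
  cluster (u k @[k --> \oo]) v -> cluster (u k.+1 @[k --> \oo]) v.
Proof. by apply: cvg_cluster => B; exact: near_inftyS. Qed.

Section equicontinuous_sequences.
Context {R : realType} {V : topologicalType}.
Implicit Types (K : set V) (h : nat -> V -> R) (x : nat -> V).

Definition equicontinuous_on {I : Type} K (g : I -> V -> R) : Prop :=
  forall y, K y -> forall e : R, 0 < e ->
  \forall z \near within K (nbhs y), forall i, `|g i z - g i y| < e.

Lemma equicontinuous_onB {I : Type} K (g h : I -> V -> R) :
  equicontinuous_on K g -> equicontinuous_on K h ->
  equicontinuous_on K (fun i y => g i y - h i y).
Proof.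
move=> gK hK y Ky e e0; have e2 : 0 < e / 2 by rewrite divr_gt0.
apply: filterS2 (gK y Ky _ e2) (hK y Ky _ e2) => z gz hz i.
by have := gz i; have := hz i; rewrite !ltr_norml; lra.
Qed.

Lemma equicontinuous_cvg0_unif K h : compact K -> equicontinuous_on K h ->
  (forall y, K y -> h k y @[k --> \oo] --> 0) ->
  forall e : R, 0 < e -> \forall k \near \oo, forall y, K y -> `|h k y| < e.
Proof.
move=> /compact_near_coveringP/near_covering_withinP cK hK h0 e e0.
apply: (cK nat \oo (fun k y => `|h k y| < e)) => y Ky.
have e2 : 0 < e / 2 by rewrite divr_gt0.
have /cvgr0_norm_lt/(_ _ e2) hy := h0 y Ky.
exists ([set z | K z -> forall k, `|h k z - h k y| < e / 2],
        [set k | `|h k y| < e / 2]) => /=.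
  by split => //; exact: hK.
move=> [z k] /= [hzy hky] Kz; rewrite -[h k z](subrK (h k y)) (splitr e).
by rewrite (le_lt_trans (ler_normD _ _))// ltrD// hzy.
Qed.

Lemma cvg_decrement (u : R^nat) : cvgn u -> u k - u k.+1 @[k --> \oo] --> 0.
Proof.
move=> cu; rewrite -(subrr (limn u)); apply: cvgB => //.
by rewrite (cvg_shiftS u).
Qed.

Section nonincreasing.
Variables (K : set V) (g : nat -> V -> R).
Hypothesis g_equi : equicontinuous_on K g.
Hypothesis g_ge0 : forall k y, K y -> 0 <= g k y.
Hypothesis g_ni : forall k y, K y -> g k.+1 y <= g k y.

Lemma diagonal_decrement_cvg0 x : compact K -> (forall k, K (x k)) ->
  g k (x k) - g k.+1 (x k) @[k --> \oo] --> 0.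
Proof.
move=> cK Kx; apply/cvgr0Pnorm_lt => e e0.
have unif :=
  @equicontinuous_cvg0_unif K (fun k y => g k y - g k.+1 y) cK _ _ e e0.
apply: filterS (unif _ _) => [k /(_ _ (Kx k))//||y Ky].
  apply: equicontinuous_onB => // y Ky r r0.
  by apply: filterS (g_equi Ky r0) => z gzy k; exact: gzy.
apply/cvg_decrement/nonincreasing_is_cvgn.
  by apply/nonincreasing_seqP => k; exact: g_ni.
by exists 0 => _ [k _ <-]; exact: g_ge0.
Qed.

Lemma cluster_diagonal_cvg0 x (v : V) : K v -> (forall k, K (x k)) ->
  g k (x k) @[k --> \oo] --> 0 -> cluster (x k @[k --> \oo]) v ->
  g k v @[k --> \oo] --> 0.
Proof.
move=> Kv Kx gx xv; apply/cvgr0Pnorm_lt => e e0.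
have e2 : 0 < e / 2 by rewrite divr_gt0.
have /cvgr0_norm_lt/(_ _ e2) gx_lt := gx.
have [k gk /(_ (Kx k) k) gkv] := cluster_frequently xv gx_lt (g_equi Kv e2).
have gv_ni := (nonincreasing_seqP (g ^~ v)).1 (fun j => g_ni j Kv).
exists k => // j /= kj; rewrite ger0_norm ?g_ge0//.
apply: le_lt_trans (gv_ni _ _ kj) _; move: gk gkv; rewrite /= !ltr_norml; lra.
Qed.

End nonincreasing.

End equicontinuous_sequences.

Lemma downward_ind (T : nat) (Q : nat -> Prop) :
  Q T -> (forall t, (t < T)%N -> Q t.+1 -> Q t) ->
  forall t, (t <= T)%N -> Q t.
Proof.
move=> QT QS t tT; rewrite -(subKn tT).
elim: (T - t)%N (leq_subr t T) => [|s IH] sT; first by rewrite subn0.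
apply: QS; last by rewrite subnSK//; exact: IH (ltnW sT).
by rewrite ltn_subrL /= (leq_ltn_trans _ sT).
Qed.

Lemma backward_diagonal_cvg0 {R : realType} {V : topologicalType} (T : nat)
    (K : nat -> set V) (g : nat -> nat -> V -> R) (x : nat -> nat -> V) :
  (forall t, (t <= T)%N -> compact (K t)) ->
  (forall t, (t <= T)%N -> equicontinuous_on (K t) (fun k => g k t)) ->
  (forall k t y, (t <= T)%N -> K t y -> 0 <= g k t y) ->
  (forall k t y, (t <= T)%N -> K t y -> g k.+1 t y <= g k t y) ->
  (forall k t, (t <= T)%N -> K t (x k t)) ->
  (forall k, g k.+1 T (x k T) <= 0) ->
  (forall k t, (t < T)%N -> g k.+1 t (x k t) <= g k t.+1 (x k t.+1)) ->
  forall t, (t <= T)%N -> g k t (x k t) @[k --> \oo] --> 0.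
Proof.
move=> cK gK g0 gni Kx gT gS.
have decr t : (t <= T)%N ->
    g k t (x k t) - g k.+1 t (x k t) @[k --> \oo] --> 0.
  move=> tT; apply: (@diagonal_decrement_cvg0 _ _ (K t) (fun k => g k t)) => //.
  - exact: gK.
  - by move=> k y; exact: g0.
  - by move=> k y; exact: gni.
  - exact: cK.
  - by move=> k; exact: Kx.
have gx_ge0 k t : (t <= T)%N -> 0 <= g k t (x k t).
  by move=> tT; apply: g0 => //; exact: Kx.
apply: downward_ind => [|t tT IH].
  apply: squeeze_cvgr (cvg_cst 0) (decr T (leqnn T)); apply: nearW => k.
  by rewrite gx_ge0//=; have := gT k; lra.
have : g k t (x k t) - g k.+1 t (x k t) + g k t.+1 (x k t.+1)
    @[k --> \oo] --> 0.
  by rewrite -[X in _ --> X]addr0; exact: cvgD (decr t (ltnW tT)) IH.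
apply: squeeze_cvgr (cvg_cst 0); apply: nearW => k.
by rewrite gx_ge0 1?ltnW//=; have := gS k t tT; lra.
Qed.

Section envelopes.
Context {R : realType} {n : nat}.
Local Notation xfun := ('rV[R]_n -> \bar R).
Implicit Types (F G : set xfun) (phi : xfun) (D : set 'rV[R]_n).
Implicit Types (N : 'rV[R]_n -> R) (L : R) (x y : 'rV[R]_n).

Lemma inf_of_glb F x (a : \bar R) :
  (a <= inf_of F x)%E <-> forall phi, F phi -> (a <= phi x)%E.
Proof.
split=> [/ereal_infP aF phi Fphi|aF]; first by apply: aF; exists phi.
by apply/ereal_infP => _ [phi Fphi <-]; exact: aF.
Qed.

Lemma sup_of_lub F x (a : \bar R) :
  (sup_of F x <= a)%E <-> forall phi, F phi -> (phi x <= a)%E.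
Proof.
split=> [/ereal_supP aF phi Fphi|aF]; first by apply: aF; exists phi.
by apply/ereal_supP => _ [phi Fphi <-]; exact: aF.
Qed.

Lemma inf_of_le F phi x : F phi -> (inf_of F x <= phi x)%E.
Proof. exact: (inf_of_glb F x _).1. Qed.

Lemma sup_of_ge F phi x : F phi -> (phi x <= sup_of F x)%E.
Proof. exact: (sup_of_lub F x _).1. Qed.

Lemma sup_ofE F :
  sup_of F = fun x => (- inf_of [set (fun y => - phi y)%E | phi in F] x)%E.
Proof.
by apply/funext => x; rewrite /sup_of ereal_supEN /inf_of !image_comp.
Qed.

Lemma finite_inf_of_mem F x : finite_set F -> F !=set0 ->
  exists2 phi, F phi & phi x = inf_of F x.
Proof.
move=> finF F0; apply: (@finite_ereal_inf_mem _ [set phi x | phi in F]).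
  exact: finite_image.
exact: image_nonempty.
Qed.

Lemma elipschitz_onN N L D phi :
  elipschitz_on N L D phi -> elipschitz_on N L D (fun x => - phi x)%E.
Proof.
move=> [phi_fin phiL]; split=> [x Dx|x y Dx Dy].
  by rewrite fin_numN phi_fin.
by rewrite !fineN -opprD normrN phiL.
Qed.

Lemma elipschitz_on_inf_of N L D F : finite_set F -> F !=set0 ->
  (forall phi, F phi -> elipschitz_on N L D phi) ->
  elipschitz_on N L D (inf_of F).
Proof.
move=> finF F0 FL.
have inf_fin x : D x -> inf_of F x \is a fin_num.
  move=> Dx; have [phi /FL[phi_fin _] <-] := finite_inf_of_mem x finF F0.
  exact: phi_fin.
split=> // x y Dx Dy.
have [phi /[dup] Fphi /FL[phi_fin philip] phix] := finite_inf_of_mem x finF F0.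
have [psi /[dup] Fpsi /FL[psi_fin psilip] psiy] := finite_inf_of_mem y finF F0.
have : fine (inf_of F x) <= fine (psi x).
  by rewrite fine_le ?inf_fin ?psi_fin//; exact: inf_of_le.
have : fine (inf_of F y) <= fine (phi y).
  by rewrite fine_le ?inf_fin ?phi_fin//; exact: inf_of_le.
rewrite -phix -psiy; have := philip x y Dx Dy; have := psilip x y Dx Dy.
rewrite !ler_norml; lra.
Qed.

Lemma elipschitz_on_sup_of N L D F : finite_set F -> F !=set0 ->
  (forall phi, F phi -> elipschitz_on N L D phi) ->
  elipschitz_on N L D (sup_of F).
Proof.
move=> finF F0 FL; rewrite sup_ofE.
apply/elipschitz_onN/elipschitz_on_inf_of.
- exact: finite_image.
- exact: image_nonempty.
- by move=> _ [phi /FL phiL <-]; exact: elipschitz_onN.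
Qed.

Lemma elipschitz_equicontinuous_on {I : Type} L D (phi : I -> xfun) :
  (forall i, elipschitz_on (@enorm R n) L D (phi i)) ->
  equicontinuous_on D (fun i x => fine (phi i x)).
Proof.
move=> phiL x Dx e e0.
have L0 : 0 < `|L| + 1 by rewrite ltr_wpDl.
have := near_enorm_lt x (divr_gt0 e0 L0).
apply: filterS => y yx Dy i; apply: le_lt_trans ((phiL i).2 y x Dy Dx) _.
move: yx; rewrite ltr_pdivlMr// mulrC; apply: le_lt_trans.
by rewrite ler_wpM2r ?enorm_ge0// ler_wpDr// ler_norm.
Qed.

End envelopes.

Section bellman_operators.
Context {R : realType} {n m : nat} {d : measure_display}.
Context {Omega : measurableType d} {P : probability Omega R}.
Context {dW : nat -> measure_display} {W : forall t, measurableType (dW t)}.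
Local Notation xfun := ('rV[R]_n -> \bar R).
Variables (p : msp n m P W) (LV : nat -> R).
Implicit Types (t : nat) (F : set xfun) (phi psi : xfun) (x y : 'rV[R]_n).

Lemma basic_fin_num t phi x :
  basic p LV t phi -> Xset p t x -> phi x \is a fin_num.
Proof. by move=> [[+ _] _]; apply. Qed.

Lemma basic_lty t phi x : basic p LV t phi -> (phi x < +oo)%E <-> Xset p t x.
Proof.
move=> phi_basic; split=> [|Xx]; last first.
  by rewrite ltey_eq (basic_fin_num phi_basic).
by apply: contraPP => Xx; rewrite phi_basic.2.
Qed.

Lemma basic_inf_of t F : finite_set F -> F !=set0 -> F `<=` basic p LV t ->
  basic p LV t (inf_of F).
Proof.
move=> finF F0 Fb; split=> [|x Xx].
  by apply: elipschitz_on_inf_of => // phi /Fb[].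
have [phi /Fb[_ phi_out] <-] := finite_inf_of_mem x finF F0.
exact: phi_out.
Qed.

Lemma basic_sup_of t F : finite_set F -> F !=set0 -> F `<=` basic p LV t ->
  basic p LV t (sup_of F).
Proof.
move=> finF F0 Fb; split=> [|x Xx].
  by apply: elipschitz_on_sup_of => // phi /Fb[].
case: F0 => phi Fphi; apply/eqP; rewrite -leye_eq -((Fb _ Fphi).2 x Xx).
exact: sup_of_ge.
Qed.

Lemma le_bellman t phi psi x : (forall y, (phi y <= psi y)%E) ->
  (bellman p t phi x <= bellman p t psi x)%E.
Proof.
move=> phipsi; apply: ae_le_eexpectation; apply: aeW => o.
apply/ereal_infP => _ [u _ <-].
apply: (@le_trans _ _ (stage_cost p (noise p t.+1 o) phi x u)).
  by apply: ereal_inf_lbound; exists u.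
by apply: lee_dD2l; exact: phipsi.
Qed.

Lemma bellman_at_argmin t (w : W t.+1) phi x u :
  (forall v, (stage_cost p w phi x u <= stage_cost p w phi x v)%E) ->
  bellman_at p w phi x = stage_cost p w phi x u.
Proof.
move=> umin; apply/eqP; rewrite eq_le ereal_inf_lbound /=; last by exists u.
by apply/ereal_infP => _ [v _ <-].
Qed.

Lemma Uset_stage_cost_lty t (w : W t.+1) phi x u : basic p LV t.+1 phi ->
  Uset p w x u <-> (stage_cost p w phi x u < +oo)%E.
Proof.
move=> phi_basic; rewrite ltey dadde_eq_pinfty negb_or -!ltey /Uset/=.
split=> [[-> Xu]|/andP[cy phiy]]; first exact/(basic_lty _ phi_basic).
by split=> //; apply/(basic_lty _ phi_basic).
Qed.

Lemma stage_cost_finE t (w : W t.+1) phi x u : basic p LV t.+1 phi ->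
  (-oo < cost p w (x, u))%E -> Uset p w x u ->
  stage_cost p w phi x u =
    (fine (cost p w (x, u)) + fine (phi (dyn p w (x, u))))%:E.
Proof.
move=> phi_basic cNy [cy Xu]; rewrite /stage_cost dEFinD !fineK//.
  exact: basic_fin_num Xu.
by rewrite fin_real// cNy.
Qed.

Lemma argmin_in_Uset t (w : W t.+1) phi x u :
  basic p LV t.+1 phi -> Uset p w x !=set0 ->
  (forall v, (stage_cost p w phi x u <= stage_cost p w phi x v)%E) ->
  Uset p w x u.
Proof.
move=> phi_basic [v /(Uset_stage_cost_lty _ _ _ phi_basic) vy] umin.
by apply/(Uset_stage_cost_lty _ _ _ phi_basic); exact: le_lt_trans (umin v) vy.
Qed.

(* Evaluating the stage cost of [psi] at the minimizer for [phi] bounds the gap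
   of the Bellman images by the worst gap at the successor states. *)
Lemma bellman_leD t phi psi x (u : W t.+1 -> 'rV[R]_m) (r : R) :
  finitely_supported p t.+1 ->
  (forall w z, supp p t.+1 w -> (-oo < cost p w z)%E) ->
  (forall w, supp p t.+1 w -> Uset p w x !=set0) ->
  basic p LV t.+1 phi -> basic p LV t.+1 psi ->
  (forall w, supp p t.+1 w -> forall v,
     (stage_cost p w phi x (u w) <= stage_cost p w phi x v)%E) ->
  (forall w, supp p t.+1 w ->
     (psi (dyn p w (x, u w)) - phi (dyn p w (x, u w)) <= r%:E)%E) ->
  (bellman p t psi x <= bellman p t phi x + r%:E)%E.
Proof.
move=> [mN finS PS] cNy U0 phi_basic psi_basic umin gap.
have uU w : supp p t.+1 w -> Uset p w x (u w).
  by move=> Sw; apply: (argmin_in_Uset phi_basic (U0 w Sw)); exact: umin.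
have phiE w (Sw : supp p t.+1 w) :=
  stage_cost_finE phi_basic (cNy w _ Sw) (uU w Sw).
have psiE w (Sw : supp p t.+1 w) :=
  stage_cost_finE psi_basic (cNy w _ Sw) (uU w Sw).
apply: (eexpectation_finite_noise_leD mN finS PS
  (g1 := fun w => bellman_at p w phi x)
  (g2 := fun w => bellman_at p w psi x)) => w Sw;
  rewrite (bellman_at_argmin (umin w Sw)) phiE//.
apply: (@le_trans _ _ (stage_cost p w psi x (u w))).
  by apply: ereal_inf_lbound; exists (u w).
have [_ Xu] := uU w Sw; have := gap w Sw.
rewrite psiE// -(fineK (basic_fin_num psi_basic Xu)).
rewrite -(fineK (basic_fin_num phi_basic Xu)) -!EFinD !lee_fin; lra.
Qed.

End bellman_operators.

Section backward_families.
Context {V E : Type}.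
Implicit Types (A : set (V -> E)) (phi psi : V -> E) (y z : V) (t k : nat).
Variables (T : nat) (S : nat -> set (V -> E) -> V -> V -> E) (ST : V -> V -> E).
Variables (x : nat -> nat -> V) (F : nat -> nat -> set (V -> E)).

Record backward_families : Prop := BackwardFamilies {
  families0 : forall t, (t <= T)%N -> F 0%N t = set0;
  families_final : forall k, F k.+1 T = F k T `|` [set ST (x k T)];
  families_step : forall k t, (t < T)%N ->
    F k.+1 t = F k t `|` [set S t (F k.+1 t.+1) (x k t)]
}.

Hypothesis F_backward : backward_families.

Lemma families_setU1 k t :
  (t <= T)%N -> exists phi, F k.+1 t = F k t `|` [set phi].
Proof.
rewrite leq_eqVlt => /predU1P[->|tT].
  by rewrite (families_final F_backward); eexists.
by rewrite (families_step F_backward)//; eexists.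
Qed.

Lemma families_nondecreasing k t : (t <= T)%N -> F k t `<=` F k.+1 t.
Proof. by move=> /(families_setU1 k)[phi ->]; exact: subsetUl. Qed.

Lemma families_neq0 k t : (t <= T)%N -> F k.+1 t !=set0.
Proof. by move=> /(families_setU1 k)[phi ->]; exists phi; right. Qed.

Lemma finite_families k t : (t <= T)%N -> finite_set (F k t).
Proof.
move=> tT; elim: k => [|k IH]; first by rewrite (families0 F_backward).
by have [phi ->] := families_setU1 k tT; rewrite finite_setU.
Qed.

Variables (le : rel E) (env : set (V -> E) -> V -> E).
Variables (D : nat -> set V) (G : nat -> set (V -> E)).
Variables (B : nat -> (V -> E) -> V -> E) (VT : V -> E).

(* The upper approximations are the case where [le] is [<=] and [env] the
   infimum, the lower ones the case where [le] is [>=] and [env] the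
   supremum. *)
Record is_envelope : Prop := IsEnvelope {
  envelope_refl : reflexive le;
  envelope_trans : transitive le;
  envelope_glb : forall A y e,
    le e (env A y) <-> forall phi, A phi -> le e (phi y)
}.

Definition selection t (St : set (V -> E) -> V -> V -> E) : Prop :=
  forall A y, finite_set A -> A !=set0 -> A `<=` G t.+1 -> D t y ->
  [/\ G t (St A y), St A y y = B t (env A) y &
      forall z, D t z -> le (B t (env A) z) (St A y z)].

Definition selection_final : Prop :=
  forall y, D T y ->
  [/\ G T (ST y), ST y y = VT y & forall z, D T z -> le (VT z) (ST y z)].

Hypothesis S_sel : forall t, (t < T)%N -> selection t (S t).
Hypothesis ST_sel : selection_final.

Lemma families_admissible k :
  (forall j t, (j < k)%N -> (t <= T)%N -> D t (x j t)) ->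
  forall t, (t <= T)%N -> F k t `<=` G t.
Proof.
elim: k => [_ t tT|k IH x_in]; first by rewrite (families0 F_backward).
have {}IH := IH (fun j t jk => x_in j t (leqW jk)).
apply: downward_ind => [|t tT FG].
  rewrite (families_final F_backward) => phi [/(IH _ (leqnn T))//|->].
  by have [] := ST_sel (x_in k T (ltnSn k) (leqnn T)).
rewrite (families_step F_backward)// => phi [/(IH _ (ltnW tT))//|->].
by have [] := S_sel tT (finite_families _ tT) (families_neq0 k tT) FG
  (x_in k t (ltnSn k) (ltnW tT)).
Qed.

Hypothesis envP : is_envelope.
Hypothesis B_homo : forall t phi psi y,
  (forall z, le (phi z) (psi z)) -> le (B t phi y) (B t psi y).
Hypothesis x_in : forall k t, (t <= T)%N -> D t (x k t).

Lemma envelope_le A phi y : A phi -> le (env A y) (phi y).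
Proof. exact: (envelope_glb envP A y _).1 (envelope_refl envP _) phi. Qed.

Lemma envelope_monotone k t y :
  (t <= T)%N -> le (env (F k.+1 t) y) (env (F k t) y).
Proof.
move=> tT; apply/(envelope_glb envP) => phi Fphi; apply: envelope_le.
exact: families_nondecreasing Fphi.
Qed.

Lemma selection_on_families k t : (t < T)%N ->
  S t (F k.+1 t.+1) (x k t) (x k t) = B t (env (F k.+1 t.+1)) (x k t) /\
  forall y, D t y ->
    le (B t (env (F k.+1 t.+1)) y) (S t (F k.+1 t.+1) (x k t) y).
Proof.
move=> tT; have FG : F k.+1 t.+1 `<=` G t.+1.
  by apply: families_admissible => // j s _; exact: x_in.
by have [] := S_sel tT (finite_families k.+1 tT) (families_neq0 k tT) FG
  (x_in k (ltnW tT)).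
Qed.

Lemma final_envelope_valid k y : D T y -> le (VT y) (env (F k T) y).
Proof.
move=> Dy; apply/(envelope_glb envP); elim: k => [|k IH] phi.
  by rewrite (families0 F_backward).
rewrite (families_final F_backward) => -[/IH//|->].
by have [_ _] := ST_sel (x_in k (leqnn T)); apply.
Qed.

Lemma envelope_valid k t y : (t < T)%N -> D t y ->
  le (B t (env (F k t.+1)) y) (env (F k t) y).
Proof.
move=> tT Dy; apply/(envelope_glb envP); elim: k => [|k IH] phi.
  by rewrite (families0 F_backward) 1?ltnW.
rewrite (families_step F_backward)// => -[/IH|->]; last first.
  exact: (selection_on_families k tT).2.
by apply: (envelope_trans envP); apply: B_homo => z; exact: envelope_monotone.
Qed.

Lemma final_envelope_tight k : le (env (F k.+1 T) (x k T)) (VT (x k T)).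
Proof.
have [_ <- _] := ST_sel (x_in k (leqnn T)).
by apply: envelope_le; rewrite (families_final F_backward); right.
Qed.

Lemma envelope_tight k t : (t < T)%N ->
  le (env (F k.+1 t) (x k t)) (B t (env (F k t.+1)) (x k t)).
Proof.
move=> tT; apply: (envelope_trans envP (y := B t (env (F k.+1 t.+1)) (x k t))).
  rewrite -(selection_on_families k tT).1.
  by apply: envelope_le; rewrite (families_step F_backward)//; right.
by apply: B_homo => z; exact: envelope_monotone.
Qed.

End backward_families.

Section ereal_envelopes.
Context {R : realType} {n : nat}.

Lemma inf_of_envelope : is_envelope <=%O (@inf_of R n).
Proof. by split; [exact: lexx|exact: le_trans|exact: inf_of_glb]. Qed.

Lemma sup_of_envelope : is_envelope >=%O (@sup_of R n).
Proof.
split; [exact: lexx| |exact: sup_of_lub].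
by move=> ? ? ? /[swap]; exact: le_trans.
Qed.

End ereal_envelopes.

Section trajectories.
Context {R : realType} {n m : nat} {d : measure_display}.
Context {Omega : measurableType d} {P : probability Omega R}.
Context {dW : nat -> measure_display} {W : forall t, measurableType (dW t)}.
Variables (p : msp n m P W) (LV : nat -> R).
Hypothesis init_in : Xset p 0 (init_state p).

Lemma admissible_trajectory_in_Xset (x : nat -> 'rV[R]_n) :
  admissible_trajectory p x -> forall t, (t <= horizon p)%N -> Xset p t (x t).
Proof.
move=> [x0 xS] [_|t tT]; first by rewrite x0.
by have [w [u [_ [_ +] ->]]] := xS t tT.
Qed.

Hypothesis U_nonempty : forall t (w : W t.+1) (y : 'rV[R]_n),
  (t < horizon p)%N -> supp p t.+1 w -> Xset p t y -> Uset p w y !=set0.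

Lemma problem_child_in_Xset (phibar philow : nat -> 'rV[R]_n -> \bar R)
    (x : nat -> 'rV[R]_n) :
  (forall t, (t <= horizon p)%N -> basic p LV t (philow t)) ->
  problem_child p phibar philow x ->
  forall t, (t <= horizon p)%N -> Xset p t (x t).
Proof.
move=> low_basic [x0 xS]; elim=> [_|t IH tT]; first by rewrite x0.
have [u [w [umin Sw _ ->]]] := xS t tT.
have := argmin_in_Uset (low_basic t.+1 tT) _ (umin w Sw).
by case=> //; exact: U_nonempty (IH (ltnW tT)).
Qed.

End trajectories.

Section tropical_dynamic_programming.
Context {R : realType} {n m : nat} {d : measure_display}.
Context {Omega : measurableType d} {P : probability Omega R}.
Context {dW : nat -> measure_display} {W : forall t, measurableType (dW t)}.
Local Notation xfun := ('rV[R]_n -> \bar R).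
Variable p : msp n m P W.
Local Notation T := (horizon p).
Hypothesis cost_gtNy : forall t (w : W t.+1) (z : 'rV[R]_n * 'rV[R]_m),
  (t < T)%N -> supp p t.+1 w -> (-oo < cost p w z)%E.
Hypothesis noise_finite : forall t, (1 <= t <= T)%N -> finitely_supported p t.
Hypothesis X_compact : forall t, (t <= T)%N -> compact (Xset p t).
Hypothesis init_in : Xset p 0 (init_state p).
Hypothesis U_nonempty : forall t (w : W t.+1) (x : 'rV[R]_n),
  (t < T)%N -> supp p t.+1 w -> Xset p t x -> Uset p w x !=set0.
Variable LV : nat -> R.
Variables Fbar Flow : nat -> set xfun.
Hypothesis Fbar_basic : forall t, (t <= T)%N -> Fbar t `<=` basic p LV t.
Hypothesis Flow_basic : forall t, (t <= T)%N -> Flow t `<=` basic p LV t.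
Variables (Sbar Slow : nat -> set xfun -> 'rV[R]_n -> xfun).
Variables (SbarT SlowT : 'rV[R]_n -> xfun).
Hypothesis Sbar_sel : forall t, (t < T)%N -> upper_selection p Fbar t (Sbar t).
Hypothesis Slow_sel : forall t, (t < T)%N -> lower_selection p Flow t (Slow t).
Hypothesis SbarT_sel : upper_selection_final p Fbar SbarT.
Hypothesis SlowT_sel : lower_selection_final p Flow SlowT.
Variables (Fb Fl : nat -> nat -> set xfun) (x : nat -> nat -> 'rV[R]_n).
Hypothesis run : tdp_run p Sbar Slow SbarT SlowT Fb Fl x.

Lemma upper_families : backward_families T Sbar SbarT x Fb.
Proof.
case: run => F0 _ _ FT FS; split=> [t /F0[]//|k|k t tT].
  by have [] := FT k.
by have [] := FS k t tT.
Qed.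

Lemma lower_families : backward_families T Slow SlowT x Fl.
Proof.
case: run => F0 _ _ FT FS; split=> [t /F0[]//|k|k t tT].
  by have [] := FT k.
by have [] := FS k t tT.
Qed.

(* The families are empty before iteration 0, hence the shift by one. *)
Local Notation upper k t := (inf_of (Fb k.+1 t)).
Local Notation lower k t := (sup_of (Fl k.+1 t)).

(* The trajectory of iteration [k.+1] is controlled by the lower approximation,
   which is itself built along the trajectories of iterations up to [k]. *)
Lemma lower_basic_of_trajectories k :
  (forall j t, (j < k.+1)%N -> (t <= T)%N -> Xset p t (x j t)) ->
  forall t, (t <= T)%N -> basic p LV t (lower k t).
Proof.
move=> x_in t tT; apply: basic_sup_of.
- exact: finite_families lower_families _ _ tT.
- exact: families_neq0 lower_families _ _ tT.
- apply: subset_trans (Flow_basic tT).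
  exact: (families_admissible (le := >=%O) lower_families Slow_sel SlowT_sel).
Qed.

Lemma trajectory_in_Xset k t : (t <= T)%N -> Xset p t (x k t).
Proof.
elim/ltn_ind: k t => -[_|k IH].
  exact: (admissible_trajectory_in_Xset init_in (tdp_forward0 run)).
apply: (problem_child_in_Xset (LV := LV) _ _ _ (tdp_forward run (ltn0Sn k))).
- exact: init_in.
- exact: U_nonempty.
- by apply: lower_basic_of_trajectories => j s jk; exact: IH.
Qed.

Lemma lower_basic k t : (t <= T)%N -> basic p LV t (lower k t).
Proof.
move: t; apply: lower_basic_of_trajectories => j s _.
exact: trajectory_in_Xset.
Qed.

Lemma upper_basic k t : (t <= T)%N -> basic p LV t (upper k t).
Proof.
move=> tT; apply: basic_inf_of.
- exact: finite_families upper_families _ _ tT.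
- exact: families_neq0 upper_families _ _ tT.
- apply: subset_trans (Fbar_basic tT).
  apply: (families_admissible (le := <=%O) upper_families Sbar_sel SbarT_sel)
    => // j s _.
  exact: trajectory_in_Xset.
Qed.

Lemma upper_nonincreasing k t y :
  (t <= T)%N -> (upper k.+1 t y <= upper k t y)%E.
Proof. exact: (envelope_monotone upper_families inf_of_envelope _). Qed.

Lemma lower_nondecreasing k t y :
  (t <= T)%N -> (lower k t y <= lower k.+1 t y)%E.
Proof. exact: (envelope_monotone lower_families sup_of_envelope _). Qed.

(* Comparing the two approximations directly, instead of sandwiching the value
   function between them, avoids computing the domain of the latter. *)
Lemma lower_le_upper k t y : (t <= T)%N -> (lower k t y <= upper k t y)%E.
Proof.
move=> tT; move: t tT y; apply: downward_ind => [|t tT IH] y.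
  have [Xy|Xy] := pselect (Xset p T y); last first.
    by rewrite (upper_basic k (leqnn T)).2// leey.
  apply: (@le_trans _ _ (value p T y)).
    exact: (final_envelope_valid lower_families SlowT_sel sup_of_envelope
      trajectory_in_Xset).
  exact: (final_envelope_valid upper_families SbarT_sel inf_of_envelope
    trajectory_in_Xset).
have [Xy|Xy] := pselect (Xset p t y); last first.
  by rewrite (upper_basic k (ltnW tT)).2// leey.
apply: le_trans (le_trans (le_bellman p t y IH) _).
  by apply: (envelope_valid lower_families Slow_sel SlowT_sel sup_of_envelope)
    => // [s phi psi z|]; [exact: le_bellman|exact: trajectory_in_Xset].
by apply: (envelope_valid upper_families Sbar_sel SbarT_sel inf_of_envelope)
  => // [s phi psi z|]; [exact: le_bellman|exact: trajectory_in_Xset].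
Qed.

Definition gap k t y : R := fine (upper k t y) - fine (lower k t y).

Lemma upper_fin_num k t y :
  (t <= T)%N -> Xset p t y -> upper k t y \is a fin_num.
Proof. by move=> tT; exact: basic_fin_num (upper_basic k tT). Qed.

Lemma lower_fin_num k t y :
  (t <= T)%N -> Xset p t y -> lower k t y \is a fin_num.
Proof. by move=> tT; exact: basic_fin_num (lower_basic k tT). Qed.

Lemma gapE k t y : (t <= T)%N -> Xset p t y ->
  (upper k t y - lower k t y)%E = (gap k t y)%:E.
Proof.
by move=> tT Xy; rewrite EFinB !fineK// ?lower_fin_num ?upper_fin_num.
Qed.

Lemma upperE k t y : (t <= T)%N -> Xset p t y ->
  upper k t y = (lower k t y + (gap k t y)%:E)%E.
Proof. by move=> tT Xy; rewrite -gapE// addeC subeK// lower_fin_num. Qed.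

Lemma gap_le k t y (r : R) : (t <= T)%N -> Xset p t y ->
  (upper k t y <= lower k t y + r%:E)%E -> gap k t y <= r.
Proof. by move=> tT Xy; rewrite upperE// leeD2lE ?lower_fin_num// lee_fin. Qed.

Lemma gap_ge0 k t y : (t <= T)%N -> Xset p t y -> 0 <= gap k t y.
Proof.
move=> tT Xy; rewrite subr_ge0 fine_le ?lower_le_upper//.
  exact: lower_fin_num.
exact: upper_fin_num.
Qed.

Lemma gap_nonincreasing k t y :
  (t <= T)%N -> Xset p t y -> gap k.+1 t y <= gap k t y.
Proof.
move=> tT Xy; rewrite lerB// fine_le ?upper_fin_num ?lower_fin_num//.
  exact: upper_nonincreasing.
exact: lower_nondecreasing.
Qed.

Lemma gap_equicontinuous t :
  (t <= T)%N -> equicontinuous_on (Xset p t) (fun k => gap k t).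
Proof.
move=> tT; apply: equicontinuous_onB;
  apply: (@elipschitz_equicontinuous_on _ _ _ (LV t)) => k.
  by have [] := upper_basic k tT.
by have [] := lower_basic k tT.
Qed.

Lemma gap_final_le0 k : gap k.+1 T (x k.+1 T) <= 0.
Proof.
apply: gap_le => //; first exact: trajectory_in_Xset.
rewrite adde0; apply: (@le_trans _ _ (value p T (x k.+1 T))).
  exact: (final_envelope_tight upper_families SbarT_sel inf_of_envelope
    trajectory_in_Xset).
exact: (final_envelope_tight lower_families SlowT_sel sup_of_envelope
  trajectory_in_Xset).
Qed.

Lemma gap_step_le k t : (t < T)%N ->
  gap k.+1 t (x k.+1 t) <= gap k t.+1 (x k.+1 t.+1).
Proof.
move=> tT; have tT' := ltnW tT.
have upper_tight : (upper k.+1 t (x k.+1 t) <=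
      bellman p t (upper k t.+1) (x k.+1 t))%E.
  by apply: (envelope_tight upper_families Sbar_sel SbarT_sel inf_of_envelope)
    => // [s phi psi z|]; [exact: le_bellman|exact: trajectory_in_Xset].
have lower_tight : (bellman p t (lower k t.+1) (x k.+1 t) <=
      lower k.+1 t (x k.+1 t))%E.
  by apply: (envelope_tight lower_families Slow_sel SlowT_sel sup_of_envelope)
    => // [s phi psi z|]; [exact: le_bellman|exact: trajectory_in_Xset].
apply: gap_le => //; first exact: trajectory_in_Xset.
apply: le_trans upper_tight (le_trans _ (leeD2r _ lower_tight)).
have [u [ws [umin _ gap_max xE]]] := (tdp_forward run (ltn0Sn k)).2 t tT.
apply: (bellman_leD (LV := LV) (u := u)) => //.
- exact: noise_finite.
- by move=> w z; exact: cost_gtNy.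
- by move=> w Sw; apply: U_nonempty => //; exact: trajectory_in_Xset.
- exact: lower_basic.
- exact: upper_basic.
- move=> w Sw; rewrite -gapE//; last exact: trajectory_in_Xset.
  by rewrite xE; exact: gap_max.
Qed.

Lemma gap_trajectory_cvg0 t : (t <= T)%N ->
  gap k t (x k.+1 t) @[k --> \oo] --> (0 : R).
Proof.
apply: (backward_diagonal_cvg0 (K := Xset p) (x := fun k => x k.+1)).
- exact: X_compact.
- exact: gap_equicontinuous.
- exact: gap_ge0.
- exact: gap_nonincreasing.
- by move=> k s; exact: trajectory_in_Xset.
- exact: gap_final_le0.
- exact: gap_step_le.
Qed.

Lemma cluster_trajectory_in_Xset t y :
  (t <= T)%N -> cluster (x k t @[k --> \oo]) y -> Xset p t y.
Proof.
move=> tT; have /closure_id -> : closed (Xset p t).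
  by apply: compact_closed; [exact: norm_hausdorff|exact: X_compact].
by rewrite clusterE; apply; exists 0%N => // k _; exact: trajectory_in_Xset.
Qed.

Lemma gap_cluster_cvg0 t y : (t <= T)%N -> cluster (x k t @[k --> \oo]) y ->
  gap k t y @[k --> \oo] --> (0 : R).
Proof.
move=> tT xy.
apply: (@cluster_diagonal_cvg0 _ _ (Xset p t) (fun k => gap k t) _ _ _
  (fun k => x k.+1 t)).
- exact: gap_equicontinuous.
- by move=> k z; exact: gap_ge0.
- by move=> k z; exact: gap_nonincreasing.
- exact: cluster_trajectory_in_Xset xy.
- by move=> k; exact: trajectory_in_Xset.
- exact: gap_trajectory_cvg0.
- exact: (@cluster_shiftS _ (fun k => x k t)).
Qed.

Lemma tdp_gap_cvg0 t : (t <= T)%N ->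
  (inf_of (Fb k t) (x k t) - sup_of (Fl k t) (x k t))%E @[k --> \oo] --> 0%E.
Proof.
move=> tT; rewrite -cvg_shiftS.
apply: (cvg_trans (G := (gap k t (x k.+1 t))%:E @[k --> \oo])).
  apply: near_eq_cvg; apply: nearW => k /=.
  by rewrite gapE//; exact: trajectory_in_Xset.
by apply: cvg_EFin; [exact: nearW|exact: gap_trajectory_cvg0].
Qed.

Lemma tdp_cluster_limits_eq t y :
  (t <= T)%N -> cluster (x k t @[k --> \oo]) y ->
  limn (fun k => inf_of (Fb k t) y) = limn (fun k => sup_of (Fl k t) y).
Proof.
move=> tT xy; have Xy := cluster_trajectory_in_Xset tT xy.
have lower_cvg : cvgn (fun k => lower k t y).
  apply/ereal_nondecreasing_is_cvgn/nondecreasing_seqP => k.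
  exact: lower_nondecreasing.
have upper_cvg : upper k t y @[k --> \oo] --> limn (fun k => lower k t y).
  under eq_fun do rewrite upperE//.
  rewrite -[limn _]adde0; apply: cvgeD => //; first exact: fin_num_adde_defl.
  by apply: cvg_EFin; [exact: nearW|exact: gap_cluster_cvg0].
transitivity (limn (fun k => lower k t y)).
  by apply/cvg_lim => //; rewrite -cvg_shiftS.
by apply/esym/cvg_lim => //; rewrite -cvg_shiftS.
Qed.

End tropical_dynamic_programming.

Theorem theorem10 (R : realType) (n m : nat)
  (d : measure_display) (Omega : measurableType d) (P : probability Omega R)
  (dW : nat -> measure_display) (W : forall t : nat, measurableType (dW t))
  (p : msp n m P W)
  (horizon_ge1 : (1 <= horizon p)%N)
  (cost_gtNy : forall (t : nat) (w : W t.+1) (z : 'rV[R]_n * 'rV[R]_m),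
     (t < horizon p)%N -> supp p t.+1 w -> (-oo < cost p w z)%E)
  (final_cost_gtNy : forall x : 'rV[R]_n, (-oo < final_cost p x)%E)
  (* (1) *)
  (noise_indep : independent_noises p)
  (noise_finite : forall t : nat, (1 <= t <= horizon p)%N ->
     finitely_supported p t)
  (* (2) *)
  (X_nonempty : forall t : nat, (t <= horizon p)%N -> Xset p t !=set0)
  (X_compact : forall t : nat, (t <= horizon p)%N -> compact (Xset p t))
  (init_in : Xset p 0 (init_state p))
  (* (3) *)
  (dyn_lip : forall (t : nat) (w : W t.+1),
     (t < horizon p)%N -> supp p t.+1 w ->
     exists L : R, lipschitz_on2 L (edom (cost p w)) (dyn p w))
  (cost_lip : forall (t : nat) (w : W t.+1),
     (t < horizon p)%N -> supp p t.+1 w ->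
     exists L : R, elipschitz_on (@enorm2 R n m) L (edom (cost p w)) (cost p w))
  (U_lip : forall (t : nat) (w : W t.+1),
     (t < horizon p)%N -> supp p t.+1 w ->
     exists L : R, 0 < L /\
       forall x1 x2 : 'rV[R]_n, Xset p t x1 -> Xset p t x2 ->
       (hausdorff_dist (Uset p w x1) (Uset p w x2)
          <= (L * enorm (x1 - x2))%:E)%E)
  (final_cost_lip : exists L : R,
     elipschitz_on (@enorm R n) L (Xset p (horizon p)) (final_cost p))
  (* (4) *)
  (U_nonempty : forall (t : nat) (w : W t.+1) (x : 'rV[R]_n),
     (t < horizon p)%N -> supp p t.+1 w -> Xset p t x -> Uset p w x !=set0)
  (U_compact : forall (t : nat) (w : W t.+1) (x : 'rV[R]_n),
     (t < horizon p)%N -> supp p t.+1 w -> Xset p t x -> compact (Uset p w x))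
  (* Lipschitz constants of the value functions *)
  (LV : nat -> R)
  (LV_gt0 : forall t : nat, (t <= horizon p)%N -> 0 < LV t)
  (value_lip : forall t : nat, (t <= horizon p)%N ->
     elipschitz_on (@enorm R n) (LV t) (Xset p t) (value p t))
  (* basic functions and selection functions *)
  (Fbar Flow : nat -> set ('rV[R]_n -> \bar R))
  (Fbar_basic : forall t : nat, (t <= horizon p)%N -> Fbar t `<=` basic p LV t)
  (Flow_basic : forall t : nat, (t <= horizon p)%N -> Flow t `<=` basic p LV t)
  (Sbar Slow :
     nat -> set ('rV[R]_n -> \bar R) -> 'rV[R]_n -> ('rV[R]_n -> \bar R))
  (SbarT SlowT : 'rV[R]_n -> ('rV[R]_n -> \bar R))
  (Sbar_sel : forall t : nat, (t < horizon p)%N ->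
     upper_selection p Fbar t (Sbar t))
  (Slow_sel : forall t : nat, (t < horizon p)%N ->
     lower_selection p Flow t (Slow t))
  (SbarT_sel : upper_selection_final p Fbar SbarT)
  (SlowT_sel : lower_selection_final p Flow SlowT)
  (* a run of TDP *)
  (Fb Fl : nat -> nat -> set ('rV[R]_n -> \bar R))
  (x : nat -> nat -> 'rV[R]_n)
  (run : tdp_run p Sbar Slow SbarT SlowT Fb Fl x) :
  forall t : nat, (t <= horizon p)%N ->
    ((inf_of (Fb k t) (x k t) - sup_of (Fl k t) (x k t))%E @[k --> \oo]
       --> 0%E) /\
    (forall xs : 'rV[R]_n, cluster (x k t @[k --> \oo]) xs ->
       limn (fun k => inf_of (Fb k t) xs) = limn (fun k => sup_of (Fl k t) xs)).
Proof.
move=> t tT; split.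
  exact: (tdp_gap_cvg0 cost_gtNy noise_finite X_compact init_in U_nonempty
    Fbar_basic Flow_basic Sbar_sel Slow_sel SbarT_sel SlowT_sel run tT).
move=> xs.
exact: (tdp_cluster_limits_eq cost_gtNy noise_finite X_compact init_in
  U_nonempty Fbar_basic Flow_basic Sbar_sel Slow_sel SbarT_sel SlowT_sel
  run tT).
Qed.
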